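(* Let $\mathcal{Q}_1,\mathcal{Q}_2,\mathcal{Q}_3$ be seminormal quasi-crystals of the same type, with underlying sets $Q_1,Q_2,Q_3$. Then the map $(Q_1\ddot{\otimes}Q_2)\ddot{\otimes}Q_3\to Q_1\ddot{\otimes}(Q_2\ddot{\otimes}Q_3)$, $(x_1\ddot{\otimes}x_2)\ddot{\otimes}x_3\mapsto x_1\ddot{\otimes}(x_2\ddot{\otimes}x_3)$, is a quasi-crystal isomorphism between $(\mathcal{Q}_1\ddot{\otimes}\mathcal{Q}_2)\ddot{\otimes}\mathcal{Q}_3$ and $\mathcal{Q}_1\ddot{\otimes}(\mathcal{Q}_2\ddot{\otimes}\mathcal{Q}_3)$.
   Context: Root system data: $V$ a finite-dimensional real inner product space, $\alpha^\vee=\frac{2}{\langle\alpha,\alpha\rangle}\alpha$; a root system $\Phi\subseteq V\setminus\{0\}$ (nonempty, finite, closed under the reflections $\beta\mapsto\beta-\langle\beta,\alpha^\vee\rangle\alpha$, with $\langle\beta,\alpha^\vee\rangle\in\mathbb{Z}$, and $\alpha,k\alpha\in\Phi\Rightarrow k=\pm1$), fixed simple roots $(\alpha_i)_{i\in I}$ and weight lattice $\Lambda$ (a $\mathbb{Z}$-submodule spanning $V$, containing $\Phi$, with $\langle\lambda,\alpha^\vee\rangle\in\mathbb{Z}$). A quasi-crystal of type $\Phi$ is a set $Q$ with maps $\mathrm{wt}:Q\to\Lambda$, $\ddot{e}_i,\ddot{f}_i:Q\to Q\sqcup\{\bot\}$ ($\bot$ = undefined), $\ddot{\varepsilon}_i,\ddot{\varphi}_i:Q\to\mathbb{Z}\cup\{\pm\infty\}$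 ($i\in I$) such that: $\ddot{\varphi}_i(x)=\ddot{\varepsilon}_i(x)+\langle\mathrm{wt}(x),\alpha_i^\vee\rangle$ (with $m+(\pm\infty)=\pm\infty$); if $\ddot{e}_i(x)\in Q$ then its weight is $\mathrm{wt}(x)+\alpha_i$, its $\ddot{\varepsilon}_i$ is $\ddot{\varepsilon}_i(x)-1$ and its $\ddot{\varphi}_i$ is $\ddot{\varphi}_i(x)+1$; if $\ddot{f}_i(x)\in Q$ then its weight is $\mathrm{wt}(x)-\alpha_i$, $\ddot{\varepsilon}_i$ is $+1$, $\ddot{\varphi}_i$ is $-1$; $\ddot{e}_i(x)=y\iff x=\ddot{f}_i(y)$; and $\ddot{\varepsilon}_i(x)=\pm\infty$ implies $\ddot{e}_i(x)=\ddot{f}_i(x)=\bot$. It is seminormal if whenever $\ddot{\varepsilon}_i(x)\neq+\infty$, $\ddot{\varepsilon}_i(x)=\max\{k\ge0:\ddot{e}_i^k(x)\in Q\}$ and $\ddot{\varphi}_i(x)=\max\{k\ge0:\ddot{f}_i^k(x)\in Q\}$. A quasi-crystal homomorphism $\psi:\mathcal{Q}\to\mathcal{Q}'$ is a map $\psi:Q\sqcup\{\bot\}\to Q'\sqcup\{\bot\}$ with $\psi(\bot)=\bot$ such that for $x\in Q$ with $\psi(x)\in Q'$, $\psi(x)$ has the same $\mathrm{wt},\ddot{\varepsilon}_i,\ddot{\varphi}_i$ as $x$, and if $\ddot{e}_i(x)\in Q$ and $\psi(x),\psi(\ddot{e}_i(x))\in Q'$ then $\psi(\ddot{e}_i(x))=\ddot{e}_i(\psi(x))$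 (same for $\ddot{f}_i$). A map $Q\to Q'$ is regarded as such a map with $\bot\mapsto\bot$. A quasi-crystal isomorphism is a bijection $\psi$ such that $\psi$ and $\psi^{-1}$ are homomorphisms. Quasi-tensor product: for seminormal $\mathcal{Q},\mathcal{Q}'$ of the same type, $\mathcal{Q}\ddot{\otimes}\mathcal{Q}'$ has underlying set $Q\times Q'$ (elements $x\ddot{\otimes}x'$), $\mathrm{wt}(x\ddot{\otimes}x')=\mathrm{wt}(x)+\mathrm{wt}(x')$, and for $i\in I$: if $\ddot{\varphi}_i(x)>0$ and $\ddot{\varepsilon}_i(x')>0$ then $\ddot{e}_i,\ddot{f}_i$ are undefined on $x\ddot{\otimes}x'$ and $\ddot{\varepsilon}_i=\ddot{\varphi}_i=+\infty$ there; otherwise $\ddot{e}_i(x\ddot{\otimes}x')$ is $\ddot{e}_i(x)\ddot{\otimes}x'$ if $\ddot{\varphi}_i(x)\ge\ddot{\varepsilon}_i(x')$ and $x\ddot{\otimes}\ddot{e}_i(x')$ otherwise, $\ddot{f}_i(x\ddot{\otimes}x')$ is $\ddot{f}_i(x)\ddot{\otimes}x'$ if $\ddot{\varphi}_i(x)>\ddot{\varepsilon}_i(x')$ and $x\ddot{\otimes}\ddot{f}_i(x')$ otherwise (with $x\ddot{\otimes}\bot=\bot\ddot{\otimes}x'=\bot$), $\ddot{\varepsilon}_i(x\ddot{\otimes}x')=\max\{\ddot{\varepsilon}_i(x),\ddot{\varepsilon}_i(x')-\langle\mathrm{wt}(x),\alpha_i^\vee\rangle\}$, $\ddot{\varphi}_i(x\ddot{\otimes}x')=\max\{\ddot{\varphi}_i(x)+\langle\mathrm{wt}(x'),\alpha_i^\vee\rangle,\ddot{\varphi}_i(x')\}$.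 This is again a seminormal quasi-crystal. *)

(* Defs.v *)
From mathcomp Require Import all_boot all_order all_algebra.
From mathcomp Require Import classical_sets cardinality reals constructive_ereal.
From mathcomp Require Import sesquilinear zify.

Set Implicit Arguments.
Unset Strict Implicit.
Unset Printing Implicit Defensive.

Import Order.TTheory GRing.Theory Num.Theory.
Local Open Scope classical_set_scope.
Local Open Scope ring_scope.

Section RootDatum.
Variables (R : realType) (V : vectType R) (ip : {dot V for idfun}).

Definition coroot (a : V) : V := (2 / ip a a) *: a.

Record is_root_system (Phi : set V) : Prop := IsRootSystem {
  rs_finite : finite_set Phi;
  rs_nonempty : Phi !=set0;
  rs_neq0 : ~ Phi 0;
  rs_reflection : forall a b, Phi a -> Phi b -> Phi (b - ip b (coroot a) *: a);
  rs_integral : forall a b, Phi a -> Phi b -> ip b (coroot a) \is a Num.int;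
  rs_reduced : forall a (k : R), Phi a -> Phi (k *: a) -> k = 1 \/ k = -1 }.

Record is_simple_system (I : finType) (Phi : set V) (alpha : I -> V) : Prop :=
  IsSimpleSystem {
  ss_root : forall i, Phi (alpha i);
  ss_free : free [seq alpha i | i : I];
  ss_decomp : forall b, Phi b -> exists c : I -> nat,
    b = \sum_i alpha i *+ c i \/ b = - \sum_i alpha i *+ c i }.

Record is_weight_lattice (Phi Lambda : set V) : Prop := IsWeightLattice {
  wl_0 : Lambda 0;
  wl_B : forall u v, Lambda u -> Lambda v -> Lambda (u - v);
  wl_span : forall v, exists s : seq V,
    (forall u, u \in s -> Lambda u) /\ v \in <<s>>%VS;
  wl_root : Phi `<=` Lambda;
  wl_integral : forall l a, Lambda l -> Phi a -> ip l (coroot a) \is a Num.int }.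

Record root_datum (I : finType) := RootDatum {
  roots : set V;
  simple : I -> V;
  weights : set V;
  rootsP : is_root_system roots;
  simpleP : is_simple_system roots simple;
  weightsP : is_weight_lattice roots weights }.

Variables (I : finType) (D : root_datum I).

(* The floor only casts the real number <l, alpha_i^vee> to int: this number is
   an integer for every weight l, see [pairE]. *)
Definition pair (l : V) (i : I) : int := Num.floor (ip l (coroot (simple D i))).

Lemma pairE l i : weights D l -> (pair l i)%:~R = ip l (coroot (simple D i)).
Proof.
move=> Dl; apply: floorK; apply: wl_integral (weightsP D) _ _ Dl _.
exact: ss_root (simpleP D) i.
Qed.

Lemma weights_root i : weights D (simple D i).
Proof. exact: wl_root (weightsP D) _ (ss_root (simpleP D) i). Qed.

Lemma weightsD u v : weights D u -> weights D v -> weights D (u + v).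
Proof.
move=> Du Dv; have DB := wl_B (weightsP D); rewrite -[v]opprK.
by apply: (DB) => //; rewrite -sub0r; apply: DB (wl_0 (weightsP D)) _.
Qed.

Lemma pairD u v i : weights D u -> weights D v ->
  pair (u + v) i = pair u i + pair v i.
Proof.
move=> Du Dv; apply: (@mulrIz R 1); first exact: oner_neq0.
rewrite mulrzDr !pairE ?linearDl //; exact: weightsD.
Qed.

Lemma pair_root i : pair (simple D i) i = 2.
Proof.
apply: (@mulrIz R 1); first exact: oner_neq0.
rewrite pairE; last exact: weights_root.
rewrite /coroot linearZ /= mulfVK //.
have Di := ss_root (simpleP D) i.
suff : 0 < ip (simple D i) (simple D i) by move/lt0r_neq0.
apply: neq0_dnorm_gt0; apply/eqP => i0.
by apply: (rs_neq0 (rootsP D)); rewrite -i0.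
Qed.

(* [None] stands for the undefined value. *)
Record quasi_crystal := QuasiCrystal {
  qc_sort :> Type;
  wt : qc_sort -> V;
  qe : I -> qc_sort -> option qc_sort;
  qf : I -> qc_sort -> option qc_sort;
  eps : I -> qc_sort -> \bar int;
  phi : I -> qc_sort -> \bar int;
  wt_weights : forall x, weights D (wt x);
  phiE : forall i x, phi i x = (eps i x + (pair (wt x) i)%:E)%E;
  qeP : forall i x y, qe i x = Some y ->
    [/\ wt y = wt x + simple D i, eps i y = (eps i x - 1)%E
      & phi i y = (phi i x + 1)%E];
  qfP : forall i x y, qf i x = Some y ->
    [/\ wt y = wt x - simple D i, eps i y = (eps i x + 1)%E
      & phi i y = (phi i x - 1)%E];
  qef : forall i x y, qe i x = Some y <-> qf i y = Some x;
  eps_infty : forall i x, eps i x = +oo%E \/ eps i x = -oo%E ->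
    qe i x = None /\ qf i x = None }.

(* l is the maximum of the set of all k such that g^k(x) is defined. *)
Definition string_length (T : Type) (g : T -> option T) (x : T) (l : \bar int) :=
  exists n : nat, [/\ l = n%:Z%:E, isSome (iter n (obind g) (Some x))
    & forall k, isSome (iter k (obind g) (Some x)) -> (k <= n)%N].

Definition seminormal (Q : quasi_crystal) := forall i (x : Q),
  eps i x <> +oo%E -> string_length (qe i) x (eps i x)
                   /\ string_length (qf i) x (phi i x).

Record sn_quasi_crystal := SNQuasiCrystal {
  snqc_qc :> quasi_crystal;
  snqc_seminormal : seminormal snqc_qc }.

Record qc_hom (Q Q' : quasi_crystal) (psi : option Q -> option Q') : Prop :=
  QCHom {
  hom_None : psi None = None;
  hom_data : forall x x', psi (Some x) = Some x' ->
    wt x' = wt x /\ forall i, eps i x' = eps i x /\ phi i x' = phi i x;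
  hom_qe : forall i x y x' y', qe i x = Some y ->
    psi (Some x) = Some x' -> psi (Some y) = Some y' -> qe i x' = Some y';
  hom_qf : forall i x y x' y', qf i x = Some y ->
    psi (Some x) = Some x' -> psi (Some y) = Some y' -> qf i x' = Some y' }.

Definition qc_iso (Q Q' : quasi_crystal) (psi : option Q -> option Q') :=
  exists psi' : option Q' -> option Q,
    [/\ cancel psi psi', cancel psi' psi, qc_hom psi & qc_hom psi'].

Section Seminormal.

Lemma iter_obind_None T (g : T -> option T) n : iter n (obind g) None = None.
Proof. by elim: n => //= n ->. Qed.

Lemma string_length0 T (g : T -> option T) x : string_length g x 0%E -> g x = None.
Proof.
case=> n [[n0] _ max_n]; case gx: (g x) => [y|//].
by have := max_n 1; rewrite /= gx -n0 => /(_ isT).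
Qed.

Lemma string_lengthS T (g : T -> option T) x n :
  string_length g x n.+1%:Z%:E -> isSome (g x).
Proof.
case=> m [[<-]] + _; rewrite iterSr /=; case: (g x) => //.
by rewrite iter_obind_None.
Qed.

Lemma string_lengthI T (g : T -> option T) (l : T -> \bar int) :
    (forall x y, g x = Some y -> l y = (l x - 1)%E) ->
    (forall x, l x = 0%E -> g x = None) ->
    (forall x n, l x = n.+1%:Z%:E -> isSome (g x)) ->
  forall x n, l x = n%:Z%:E -> string_length g x (l x).
Proof.
move=> lB l0 lS x n lx; exists n; split=> //.
- elim: n x lx => // n IHn x lx; rewrite iterSr /=.
  case gx: (g x) (lS _ _ lx) => [y|//] _; apply: IHn.
  by rewrite (lB _ _ gx) lx -EFinB; congr _%:E; lia.
- move=> k; elim: k n x lx => // k IHk n x lx; rewrite iterSr /=.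
  case gx: (g x) => [y|]; last by rewrite iter_obind_None.
  case: n lx => [/l0|n lx]; first by rewrite gx.
  move/IHk; apply; rewrite (lB _ _ gx) lx -EFinB; congr _%:E; lia.
Qed.

Variant sn_spec T (e f : option T) (c : int) : \bar int -> \bar int -> Prop :=
| SNInf of e = None & f = None : sn_spec e f c +oo%E +oo%E
| SNFin (a b : nat) of c = b%:Z - a%:Z & isSome e = (0 < a)%N
    & isSome f = (0 < b)%N : sn_spec e f c a%:Z%:E b%:Z%:E.

Lemma snP (Q : sn_quasi_crystal) i (x : Q) :
  sn_spec (qe i x) (qf i x) (pair (wt x) i) (eps i x) (phi i x).
Proof.
have [xoo|/eqP xoo] := eqVneq (eps i x) +oo%E.
  have [ex fx] := eps_infty (or_introl xoo).
  by rewrite phiE xoo; apply: SNInf.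
have [se sf] := snqc_seminormal xoo.
have := phiE i x; move: (se) (sf) => [a [ea _ _]] [b [eb _ _]].
rewrite ea eb -EFinD => -[cE].
apply: SNFin; first by lia.
- case: a ea {cE} => [|a] ea; first by rewrite string_length0 // -[X in _ X]ea.
  by rewrite (@string_lengthS _ _ _ a) // -ea.
- case: b eb {cE} => [|b] eb; first by rewrite string_length0 // -[X in _ X]eb.
  by rewrite (@string_lengthS _ _ _ b) // -eb.
Qed.

End Seminormal.

Lemma isSome_omap A B (h : A -> B) o : isSome (omap h o) = isSome o.
Proof. by case: o. Qed.

Section QuasiTensor.
Variables (Q Q' : sn_quasi_crystal).
Implicit Types (i : I) (x y : Q * Q').

Definition qt_blocked i x := (0 < phi i x.1)%E && (0 < eps i x.2)%E.

Definition qt_wt x := wt x.1 + wt x.2.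

Definition qt_e i x : option (Q * Q') :=
  if qt_blocked i x then None
  else if (eps i x.2 <= phi i x.1)%E
       then omap (fun y1 : Q => (y1, x.2)) (qe i x.1)
       else omap (fun y2 : Q' => (x.1, y2)) (qe i x.2).

Definition qt_f i x : option (Q * Q') :=
  if qt_blocked i x then None
  else if (eps i x.2 < phi i x.1)%E
       then omap (fun y1 : Q => (y1, x.2)) (qf i x.1)
       else omap (fun y2 : Q' => (x.1, y2)) (qf i x.2).

Definition qt_eps i x : \bar int :=
  if qt_blocked i x then +oo%E
  else maxe (eps i x.1) (eps i x.2 - (pair (wt x.1) i)%:E)%E.

Definition qt_phi i x : \bar int :=
  if qt_blocked i x then +oo%E
  else maxe (phi i x.1 + (pair (wt x.2) i)%:E)%E (phi i x.2).

Lemma qt_wt_weights x : weights D (qt_wt x).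
Proof. by apply: weightsD; apply: wt_weights. Qed.

Lemma qt_pair i x : pair (qt_wt x) i = pair (wt x.1) i + pair (wt x.2) i.
Proof. by apply: pairD; apply: wt_weights. Qed.

Lemma qt_snP i x :
  sn_spec (qt_e i x) (qt_f i x) (pair (qt_wt x) i) (qt_eps i x) (qt_phi i x).
Proof.
rewrite qt_pair /qt_e /qt_f /qt_eps /qt_phi /qt_blocked.
case: (snP i x.1) => [e1 f1|a b -> e1 f1]; case: (snP i x.2) => [e2 f2|a' b' -> e2 f2].
- by rewrite !ltry; constructor.
- rewrite ltry lte_fin ltz_nat; case: ltnP => [|a0]; first by constructor.
  by rewrite leey ltry e1 f1 /= maxye addye // maxye; constructor.
- rewrite ltry lte_fin ltz_nat; case: ltnP => [|a0]; first by constructor.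
  by rewrite leye_eq ltNge leey /= e2 f2 /= !maxey; constructor.
rewrite !(lte_fin, lee_fin, lez_nat, ltz_nat).
case: ifPn => [|ba]; first by constructor.
rewrite -EFinB -EFinD -!EFin_max.
have -> : Num.max a%:Z (a'%:Z - (b%:Z - a%:Z)) = (maxn a (a' + a - b))%:Z by lia.
have -> : Num.max (b%:Z + (b'%:Z - a'%:Z)) b'%:Z = (maxn (b + b' - a') b')%:Z by lia.
constructor; first by lia.
- case: ifPn => h; rewrite ?isSome_omap ?e1 ?e2; lia.
- case: ifPn => h; rewrite ?isSome_omap ?f1 ?f2; lia.
Qed.

Lemma qt_phiE i x : qt_phi i x = (qt_eps i x + (pair (qt_wt x) i)%:E)%E.
Proof. by case: qt_snP => // a b -> _ _; rewrite -EFinD; congr _%:E; lia. Qed.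

Let ereal_int := (@lte_fin int, @lee_fin int, ltz_nat, lez_nat, @leey int,
  @leye_eq int, @ltry int).

Lemma qt_eP i x y : qt_e i x = Some y ->
  [/\ qt_wt y = qt_wt x + simple D i, qt_eps i y = (qt_eps i x - 1)%E
    & qt_phi i y = (qt_phi i x + 1)%E].
Proof.
move=> exy.
suff [wy ey] : qt_wt y = qt_wt x + simple D i /\ qt_eps i y = (qt_eps i x - 1)%E.
  split=> //; rewrite !qt_phiE wy ey pairD ?pair_root ?EFinD;
    [|exact: qt_wt_weights|exact: weights_root].
  by case: (qt_eps i x) => // r; rewrite -?(EFinD,EFinB) //; congr _%:E; lia.
case: x exy => x1 x2; rewrite /qt_e; case: ifPn => //= nb; case: ifPn => h.
  case e1: (qe i x1) => [y1|] //= [<-]; have [w ep ph] := qeP e1.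
  split; first by rewrite /qt_wt /= w addrAC.
  have c1 : pair (wt y1) i = pair (wt x1) i + 2.
    by rewrite w pairD ?pair_root //; [exact: wt_weights|exact: weights_root].
  move: nb h; rewrite /qt_eps /qt_blocked /= ep ph c1.
  case: (snP i x1) => [|a b -> ex1 _]; first by rewrite e1.
  have {ex1} a0 : (0 < a)%N by rewrite -ex1 e1.
  case: (snP i x2) => [_ _|a' b' _ _ _]; first by rewrite !ereal_int.
  rewrite -!EFinB -!EFinD -!EFin_max !ereal_int => nb h.
  rewrite ifF; last by lia.
  by rewrite (negPf nb) -EFinB; congr _%:E; lia.
case e2: (qe i x2) => [y2|] //= [<-]; have [w ep ph] := qeP e2.
split; first by rewrite /qt_wt /= w addrA.
move: nb h; rewrite /qt_eps /qt_blocked /= ep.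
case: (snP i x1) => [_ _|a b -> _ _]; first by rewrite !ereal_int.
case: (snP i x2) => [|a' b' _ ex2 _]; first by rewrite e2.
have {ex2} a0 : (0 < a')%N by rewrite -ex2 e2.
rewrite -!EFinB -!EFin_max !ereal_int => nb h.
rewrite ifF; last by lia.
by rewrite (negPf nb) -EFinB; congr _%:E; lia.
Qed.

Lemma qt_fP i x y : qt_f i x = Some y ->
  [/\ qt_wt y = qt_wt x - simple D i, qt_eps i y = (qt_eps i x + 1)%E
    & qt_phi i y = (qt_phi i x - 1)%E].
Proof.
move=> fxy.
suff [wy ey] : qt_wt y = qt_wt x - simple D i /\ qt_eps i y = (qt_eps i x + 1)%E.
  have wx : qt_wt x = qt_wt y + simple D i by rewrite wy subrK.
  split=> //; rewrite !qt_phiE wx ey pairD ?pair_root ?EFinD;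
    [|exact: qt_wt_weights|exact: weights_root].
  by case: (qt_eps i x) => // r; rewrite -?(EFinD,EFinB) //; congr _%:E; lia.
case: x fxy => x1 x2; rewrite /qt_f; case: ifPn => //= nb; case: ifPn => h.
  case f1: (qf i x1) => [y1|] //= [<-]; have [w ep ph] := qfP f1.
  split; first by rewrite /qt_wt /= w addrAC.
  have c1 : pair (wt x1) i = pair (wt y1) i + 2.
    have -> : wt x1 = wt y1 + simple D i by rewrite w subrK.
    by rewrite pairD ?pair_root //; [exact: wt_weights|exact: weights_root].
  move: nb h; rewrite /qt_eps /qt_blocked /= ep ph; move: c1.
  case: (snP i x1) => [|a b -> _ fx1 c1]; first by rewrite f1.
  have {fx1} b0 : (0 < b)%N by rewrite -fx1 f1.
  case: (snP i x2) => [_ _|a' b' _ _ _]; first by rewrite !ereal_int.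
  rewrite -!EFinB -!EFinD -!EFin_max !ereal_int => nb h.
  rewrite ifF; last by lia.
  by rewrite (negPf nb) -EFinD; congr _%:E; lia.
case f2: (qf i x2) => [y2|] //= [<-]; have [w ep ph] := qfP f2.
split; first by rewrite /qt_wt /= w addrA.
move: nb h; rewrite /qt_eps /qt_blocked /= ep.
case: (snP i x1) => [_ _|a b -> _ _].
  by case: (snP i x2) => [|a' b' _ _ _]; rewrite ?f2 // !ereal_int.
case: (snP i x2) => [|a' b' _ _ fx2]; first by rewrite f2.
have {fx2} b0 : (0 < b')%N by rewrite -fx2 f2.
rewrite -!EFinB -!EFinD -!EFin_max !ereal_int => nb h.
rewrite ifF; last by lia.
by rewrite (negPf nb) -EFinD; congr _%:E; lia.
Qed.

Lemma qt_ef i x y : qt_e i x = Some y <-> qt_f i y = Some x.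
Proof.
case: x y => x1 x2 [y1 y2]; rewrite /qt_e /qt_f /qt_blocked /=; split.
- case: ifPn => // nb; case: ifPn => h.
    case e1: (qe i x1) => [z|] //= [zy <-]; rewrite {}zy in e1; have [_ ep ph] := qeP e1.
    have f1 := (qef _ _ _).1 e1; move: nb h; rewrite ph f1.
    case: (snP i x1) => [|a b _ ex1 _]; first by rewrite e1.
    have {ex1} a0 : (0 < a)%N by rewrite -ex1 e1.
    case: (snP i x2) => [|a' b' _ _ _]; first by rewrite !ereal_int.
    rewrite -!EFinD !ereal_int => nb h.
    by rewrite ifF ?ifT //; lia.
  case e2: (qe i x2) => [z|] //= [<- zy]; rewrite {}zy in e2; have [_ ep ph] := qeP e2.
  have f2 := (qef _ _ _).1 e2; move: nb h; rewrite ep f2.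
  case: (snP i x1) => [|a b _ _ _]; first by rewrite !ereal_int.
  case: (snP i x2) => [|a' b' _ ex2 _]; first by rewrite e2.
  have {ex2} a0 : (0 < a')%N by rewrite -ex2 e2.
  rewrite -!EFinB !ereal_int => nb h.
  by rewrite !ifF //; lia.
- case: ifPn => // nb; case: ifPn => h.
    case f1: (qf i y1) => [z|] //= [zy <-]; rewrite {}zy in f1; have [_ ep ph] := qfP f1.
    have e1 := (qef _ _ _).2 f1; move: nb h; rewrite ph e1.
    case: (snP i y1) => [|a b _ _ fy1]; first by rewrite f1.
    have {fy1} b0 : (0 < b)%N by rewrite -fy1 f1.
    case: (snP i y2) => [|a' b' _ _ _]; first by rewrite !ereal_int.
    rewrite -!EFinB !ereal_int => nb h.
    by rewrite ifF ?ifT //; lia.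
  case f2: (qf i y2) => [z|] //= [<- zy]; rewrite {}zy in f2; have [_ ep ph] := qfP f2.
  have e2 := (qef _ _ _).2 f2; move: nb h; rewrite ep e2.
  case: (snP i y1) => [_ _|a b _ _ _].
    by case: (snP i y2) => [|a' b' _ _ _]; rewrite ?f2 // !ereal_int.
  case: (snP i y2) => [|a' b' _ _ fy2]; first by rewrite f2.
  have {fy2} b0 : (0 < b')%N by rewrite -fy2 f2.
  rewrite -!EFinD !ereal_int => nb h.
  by rewrite !ifF //; lia.
Qed.

Lemma qt_eps_infty i x : qt_eps i x = +oo%E \/ qt_eps i x = -oo%E ->
  qt_e i x = None /\ qt_f i x = None.
Proof. by case: qt_snP => // a b _ _ _ []. Qed.

Definition qtensor_qc : quasi_crystal :=
  QuasiCrystal qt_wt_weights qt_phiE qt_eP qt_fP qt_ef qt_eps_infty.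

Lemma qtensor_seminormal : seminormal qtensor_qc.
Proof.
move=> i x; rewrite /= => xoo.
have e0 (z : Q * Q') : qt_eps i z = 0%E -> qt_e i z = None.
  by case: qt_snP => // a b _ ez _ [a0]; case: qt_e ez => //=; lia.
have eS (z : Q * Q') n : qt_eps i z = n.+1%:Z%:E -> isSome (qt_e i z).
  by case: qt_snP => // a b _ ez _ [an]; rewrite ez an.
have f0 (z : Q * Q') : qt_phi i z = 0%E -> qt_f i z = None.
  by case: qt_snP => // a b _ _ fz [b0]; case: qt_f fz => //=; lia.
have fS (z : Q * Q') n : qt_phi i z = n.+1%:Z%:E -> isSome (qt_f i z).
  by case: qt_snP => // a b _ _ fz [bn]; rewrite fz bn.
have [a ea] : exists a : nat, qt_eps i x = a%:Z%:E.
  by case: qt_snP xoo => // a b; exists a.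
have [b fb] : exists b : nat, qt_phi i x = b%:Z%:E.
  by case: qt_snP ea => // a0 b; exists b.
split.
- by apply: string_lengthI e0 eS _ _ ea => z y /qt_eP[].
- by apply: string_lengthI f0 fS _ _ fb => z y /qt_fP[].
Qed.

Definition qtensor : sn_quasi_crystal := SNQuasiCrystal qtensor_seminormal.

End QuasiTensor.

Definition qtensor_assoc (Q1 Q2 Q3 : sn_quasi_crystal)
    (x : qtensor (qtensor Q1 Q2) Q3) : qtensor Q1 (qtensor Q2 Q3) :=
  (x.1.1, (x.1.2, x.2)).

End RootDatum.

(* Main.v *)
(** By seminormality, eps_i and phi_i at each factor are either both +oo, with e_i
    and f_i undefined, or natural numbers whose difference is the pairing of the
    weight with alpha_i^vee. In each of the eight cases for three factors, the
    conditions defining the two bracketings become linear inequalities between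
    integers, and they select the same factor for e_i and f_i to act on. *)
Require Import Defs.
From mathcomp Require Import all_boot all_order all_algebra.
From mathcomp Require Import constructive_ereal zify.
From mathcomp Require Import reals sesquilinear.
Local Open Scope ring_scope.
Import Order.TTheory GRing.Theory Num.Theory.

Section Associativity.
Context {R : realType} {V : vectType R} {ip : {dot V for idfun}} {I : finType}.
Context {D : root_datum ip I}.

Section Components.
Context {Q1 Q2 Q3 : sn_quasi_crystal D}.
Implicit Types (i : I) (x : qtensor (qtensor Q1 Q2) Q3).

Local Notation assoc := (@qtensor_assoc R V ip I D Q1 Q2 Q3).

Let ereal_int := (@lte_fin int, @lee_fin int, ltz_nat, lez_nat, @leey int,
  @leye_eq int, @ltry int, @ltey int, @maxye int, @maxey int).

Lemma wt_qtensor_assoc x : wt (assoc x) = wt x.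
Proof. exact: addrA. Qed.

Let ltye (y : \bar int) : (+oo < y)%E = false.
Proof. by rewrite ltNge leey. Qed.

Local Ltac simp_ereal :=
  rewrite /= ?addye ?addey -?EFinB -?EFinD ?maxye ?maxey -?EFin_max ?ltye
    ?ereal_int /= //.

(* Innermost conditionals come first, so that every condition met is free of
   conditionals and simplifies to a comparison of integers. *)
Local Ltac split_ifs :=
  repeat match goal with |- context [if ?b then _ else _] =>
    lazymatch b with
    | context [if _ then _ else _] => fail
    | _ => case: (boolP b) => ?; simp_ereal
    end
  end.

(** Both bracketings give [+oo] exactly when some factor has [eps] equal to [+oo], or an earlier
    factor has positive [phi] and a later one positive [eps]. Otherwise both are the maximum of the
    three [eps], each lowered by the pairings of the weights to its left. *)
Lemma eps_qtensor_assoc i x : eps i (assoc x) = eps i x.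
Proof.
case: x => [[x1 x2] x3].
rewrite /= /qt_eps /qt_blocked /= /qt_phi /qt_eps /qt_blocked /= qt_pair /=.
case: (snP i x1) => [_ _|a1 b1 c1 _ _];
case: (snP i x2) => [_ _|a2 b2 c2 _ _];
case: (snP i x3) => [_ _|a3 b3 c3 _ _]; rewrite ?c1 ?c2 ?c3; simp_ereal.
all: by split_ifs; try lia; congr _%:E; lia.
Qed.

Lemma qe_qtensor_assoc i x : qe i (assoc x) = omap assoc (qe i x).
Proof.
case: x => [[x1 x2] x3].
rewrite /= /qt_e /qt_eps /qt_blocked /= /qt_phi /qt_e /qt_eps /qt_blocked /=.
case: (snP i x1) => [e1 _|a1 b1 c1 _ _];
case: (snP i x2) => [e2 _|a2 b2 c2 _ _];
case: (snP i x3) => [e3 _|a3 b3 c3 _ _];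
rewrite ?c1 ?c2 ?c3 ?e1 ?e2 ?e3; simp_ereal.
(* Inconsistent branches fall to [lia]; in the others the same [qe] sits under differently nested
   [omap]s. *)
all: by split_ifs; try lia; case: qe.
Qed.

Lemma qf_qtensor_assoc i x : qf i (assoc x) = omap assoc (qf i x).
Proof.
case: x => [[x1 x2] x3].
rewrite /= /qt_f /qt_eps /qt_blocked /= /qt_phi /qt_f /qt_eps /qt_blocked /=.
case: (snP i x1) => [_ f1|a1 b1 c1 _ _];
case: (snP i x2) => [_ f2|a2 b2 c2 _ _];
case: (snP i x3) => [_ f3|a3 b3 c3 _ _];
rewrite ?c1 ?c2 ?c3 ?f1 ?f2 ?f3; simp_ereal.
all: by split_ifs; try lia; case: qf.
Qed.

End Components.

(** The equations with [omap h] also transport undefinedness, so they pass to the inverse; [phi]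
    follows from [eps] and [wt] by [phiE]. *)
Lemma qc_iso_omap (Q Q' : quasi_crystal D) (h : Q -> Q') (h' : Q' -> Q) :
    cancel h h' -> cancel h' h ->
    (forall x, wt (h x) = wt x) -> (forall i x, eps i (h x) = eps i x) ->
    (forall i x, qe i (h x) = omap h (qe i x)) ->
    (forall i x, qf i (h x) = omap h (qf i x)) ->
  qc_iso (omap h).
Proof.
move=> hK h'K hwt heps he hf.
have hphi i x : phi i (h x) = phi i x by rewrite !phiE heps hwt.
exists (omap h'); split.
- by case=> //= x; rewrite hK.
- by case=> //= x; rewrite h'K.
- split=> [//|x _ [<-]|i x y _ _ exy [<-] [<-]|i x y _ _ fxy [<-] [<-]].
  + by split.
  + by rewrite he exy.
  + by rewrite hf fxy.
- split=> [//|x _ [<-]|i x y _ _ exy [<-] [<-]|i x y _ _ fxy [<-] [<-]].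
  + by rewrite -{2}[x]h'K hwt; split=> // i; rewrite -heps -hphi h'K.
  (* As [x = h (h' x)], [he] exhibits [y] as some [h z], whence [h' y = z]. *)
  + move: exy; rewrite -{1}[x]h'K he.
    by case: qe => //= z [<-]; rewrite hK.
  + move: fxy; rewrite -{1}[x]h'K hf.
    by case: qf => //= z [<-]; rewrite hK.
Qed.

End Associativity.

Theorem theorem5p6 (R : realType) (V : vectType R) (ip : {dot V for idfun})
    (I : finType) (D : root_datum ip I) (Q1 Q2 Q3 : sn_quasi_crystal D) :
  @qc_iso R V ip I D (qtensor (qtensor Q1 Q2) Q3) (qtensor Q1 (qtensor Q2 Q3))
    (omap (@qtensor_assoc R V ip I D Q1 Q2 Q3)).
Proof.
apply: (@qc_iso_omap _ _ _ _ _ (qtensor (qtensor Q1 Q2) Q3)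
  (qtensor Q1 (qtensor Q2 Q3)) _ (fun y => ((y.1, y.2.1), y.2.2))).
- by case=> [[]].
- by case=> [? []].
- exact: wt_qtensor_assoc.
- exact: eps_qtensor_assoc.
- exact: qe_qtensor_assoc.
- exact: qf_qtensor_assoc.
Qed.
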